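(* Let $\mathcal{A}$ be an arbitrary C*-algebra, let $X$ be a Hilbert $\mathcal{A}$-module, and suppose $T \in \mathcal{L}(X)$ admits the polar decomposition $T = \mathcal{V}|T|$. Then $T$ is a normal operator if and only if there exists a unitary operator $\mathcal{U} \in \mathcal{L}(X)$ such that $T = \mathcal{U} T^*$. In this situation, $\mathcal{U}$ commutes with $T$ and $T^*$.
   Context: A (right) Hilbert $\mathcal{A}$-module is a right $\mathcal{A}$-module $X$ with an $\mathcal{A}$-valued inner product $\langle\cdot,\cdot\rangle$, $\mathcal{A}$-linear in the second variable, with $\langle x,y\rangle=\langle y,x\rangle^*$ and $\langle x,x\rangle\ge 0$ with equality only when $x=0$, that is complete for the norm $\|x\|=\|\langle x,x\rangle\|^{1/2}$. $\mathcal{L}(X)$ is the C*-algebra of all adjointable operators on $X$, i.e. $\mathcal{A}$-linear maps $T:X\to X$ for which there is $T^*:X\to X$ with $\langle Tx,y\rangle=\langle x,T^*y\rangle$ for all $x,y\in X$. $T\in\mathcal{L}(X)$ is normal if $T^*T=TT^*$; $\mathcal{U}\in\mathcal{L}(X)$ is unitary if $\mathcal{U}^*\mathcal{U}=\mathcal{U}\mathcal{U}^*=1$; $\mathcal{V}\in\mathcal{L}(X)$ is a partial isometry if $\mathcal{V}\mathcal{V}^*\mathcal{V}=\mathcal{V}$. $|T|=(T^*T)^{1/2}$. $Ker$ and $Ran$ denote kernel and range. ''$T$ admits the polar decomposition $T=\mathcal{V}|T|$'' means that $\mathcal{V}\in\mathcal{L}(X)$ is a partial isometry with $T=\mathcal{V}|T|$,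 $Ker(\mathcal{V})=Ker(T)$, $Ker(\mathcal{V}^* )=Ker(T^* )$, $Ran(\mathcal{V})=\overline{Ran(T)}$ and $Ran(\mathcal{V}^* )=\overline{Ran(T^* )}$. Such a $\mathcal{V}$ exists (and is then unique) if and only if $X=Ker(|T|)\oplus\overline{Ran(|T|)}$ and $X=Ker(T^* )\oplus\overline{Ran(T)}$. *)

(* Defs.v *)
From HB Require Import structures.
From mathcomp Require Import all_boot all_order all_algebra.
From mathcomp Require Import complex.
From mathcomp Require Import all_classical all_reals all_analysis.

Set Implicit Arguments.
Unset Strict Implicit.
Unset Printing Implicit Defensive.
Import Order.TTheory GRing.Theory Num.Theory.
Import numFieldNormedType.Exports.
Local Open Scope classical_set_scope.
Local Open Scope complex_scope.
Local Open Scope ring_scope.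

(* The multiplication is a field of the mixin rather than a MathComp ring
   structure because C*-algebras need not have a unit.  Norms take their
   values in R[i], where the order only relates numbers with the same
   imaginary part, so `|a| is a nonnegative real. *)
HB.mixin Record isCstarAlgebra (R : realType) A
    & CompleteNormedModule R[i] A := {
  cmul : A -> A -> A ;
  cstar : A -> A ;
  cmulA : forall a b c : A, cmul a (cmul b c) = cmul (cmul a b) c ;
  cmulDl : forall a b c : A, cmul (a + b) c = cmul a c + cmul b c ;
  cmulDr : forall a b c : A, cmul a (b + c) = cmul a b + cmul a c ;
  cmulZl : forall (z : R[i]) (a b : A), cmul (z *: a) b = z *: cmul a b ;
  cmulZr : forall (z : R[i]) (a b : A), cmul a (z *: b) = z *: cmul a b ;
  ler_norm_cmul : forall a b : A, `|cmul a b| <= `|a| * `|b| ;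
  cstarK : forall a : A, cstar (cstar a) = a ;
  cstarD : forall a b : A, cstar (a + b) = cstar a + cstar b ;
  cstarZ : forall (z : R[i]) (a : A), cstar (z *: a) = Num.conj z *: cstar a ;
  cstarM : forall a b : A, cstar (cmul a b) = cmul (cstar b) (cstar a) ;
  cstar_norm : forall a : A, `|cmul (cstar a) a| = `|a| ^+ 2
}.

#[short(type="cstarAlgType")]
HB.structure Definition CstarAlgebra (R : realType) :=
  {A of CompleteNormedModule R[i] A & isCstarAlgebra R A}.

(* This form of positivity makes sense without a unit, and hence without
   spectra. *)
Definition cpos (R : realType) (A : cstarAlgType R) (a : A) : Prop :=
  exists b : A, a = cmul (cstar b) b.

(* Right Hilbert modules; [ract x a] is the right action x a.  The norm of the
   underlying complete normed space is forced to be |<x, x>|^(1/2), so that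
   completeness and closures refer to it. *)
HB.mixin Record isHilbertModule (R : realType) (A : cstarAlgType R) X
    & CompleteNormedModule R[i] X := {
  ract : X -> A -> X ;
  inner : X -> X -> A ;
  ractDl : forall (x y : X) (a : A), ract (x + y) a = ract x a + ract y a ;
  ractDr : forall (x : X) (a b : A), ract x (a + b) = ract x a + ract x b ;
  ractA : forall (x : X) (a b : A), ract x (cmul a b) = ract (ract x a) b ;
  ractZl : forall (z : R[i]) (x : X) (a : A),
    ract (z *: x) a = z *: ract x a ;
  ractZr : forall (z : R[i]) (x : X) (a : A),
    ract x (z *: a) = z *: ract x a ;
  innerDr : forall x y z : X, inner x (y + z) = inner x y + inner x z ;
  innerZr : forall (z : R[i]) (x y : X), inner x (z *: y) = z *: inner x y ;
  innerMr : forall (x y : X) (a : A),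
    inner x (ract y a) = cmul (inner x y) a ;
  inner_star : forall x y : X, inner x y = cstar (inner y x) ;
  inner_ge0 : forall x : X, cpos (inner x x) ;
  inner_eq0 : forall x : X, inner x x = 0 -> x = 0 ;
  norm_inner : forall x : X, `|x| = sqrtC `|inner x x|
}.

#[short(type="hilbertModType")]
HB.structure Definition HilbertModule (R : realType) (A : cstarAlgType R) :=
  {X of CompleteNormedModule R[i] X & isHilbertModule R A X}.

Section Adjointable.
Variables (R : realType) (A : cstarAlgType R) (X : hilbertModType A).

(* Complex linearity is listed separately because A may have no unit. *)
Definition right_linear (f : X -> X) : Prop :=
  [/\ forall x y : X, f (x + y) = f x + f y,
      forall (z : R[i]) (x : X), f (z *: x) = z *: f x
    & forall (x : X) (a : A), f (ract x a) = ract (f x) a].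

Definition is_adjoint (f g : X -> X) : Prop :=
  forall x y : X, inner (f x) y = inner x (g y) :> A.

(* An element of L(X), carrying its adjoint, which is determined by the
   operator (lemma is_adjoint_unique). *)
Record adjointable := Adjointable {
  aop :> X -> X ;
  aop_adj : X -> X ;
  aop_linear : right_linear aop ;
  aop_adjP : is_adjoint aop aop_adj
}.

Lemma innerBr (x y z : X) : inner x (y - z) = inner x y - inner x z :> A.
Proof. by rewrite -scaleN1r innerDr innerZr scaleN1r. Qed.

Lemma inner_inj (u v : X) :
  (forall x, inner x u = inner x v :> A) -> u = v.
Proof.
move=> uv; apply/eqP; rewrite -subr_eq0; apply/eqP.
by apply: inner_eq0; rewrite innerBr uv subrr.
Qed.

Lemma is_adjoint_unique (f g h : X -> X) :
  is_adjoint f g -> is_adjoint f h -> g =1 h.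
Proof. by move=> fg fh y; apply: inner_inj => x; rewrite -fg fh. Qed.

Lemma is_adjoint_sym (f g : X -> X) : is_adjoint f g -> is_adjoint g f.
Proof. by move=> fg x y; rewrite inner_star -fg -inner_star. Qed.

Lemma is_adjoint_linear (f g : X -> X) : is_adjoint f g -> right_linear g.
Proof.
move=> fg; split.
- by move=> x y; apply: inner_inj => u; rewrite -fg !innerDr -!fg.
- by move=> z x; apply: inner_inj => u; rewrite -fg !innerZr -!fg.
- by move=> x a; apply: inner_inj => u; rewrite -fg !innerMr -!fg.
Qed.

Definition adj (T : adjointable) : adjointable :=
  Adjointable (is_adjoint_linear (aop_adjP T)) (is_adjoint_sym (aop_adjP T)).

Definition Ker (T : adjointable) : set X := [set x | T x = 0].
Definition Ran (T : adjointable) : set X := range T.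

Definition normal (T : adjointable) : Prop := adj T \o T =1 T \o adj T.

Definition unitary (U : adjointable) : Prop :=
  adj U \o U =1 id /\ U \o adj U =1 id.

Definition partial_isometry (V : adjointable) : Prop :=
  V \o adj V \o V =1 V.

(* Positivity in the C*-algebra L(X). *)
Definition positive (P : adjointable) : Prop :=
  exists S : adjointable, P =1 adj S \o S.

(* P = |T|: the positive square root of T* T in L(X). *)
Definition is_modulus (T P : adjointable) : Prop :=
  positive P /\ P \o P =1 adj T \o T.

Definition polar_decomposition (T V P : adjointable) : Prop :=
  [/\ is_modulus T P, partial_isometry V /\ T =1 V \o P,
      Ker V = Ker T /\ Ker (adj V) = Ker (adj T),
      Ran V = closure (Ran T)
    & Ran (adj V) = closure (Ran (adj T))].

End Adjointable.

(* Main.v *)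
(* If T = U T^* with U unitary then T^* = T U^* and T = T^* U, so that
   T^* T = T U^* U T^* = T T^* and U commutes with T and T^*.

   Conversely let T = V P be normal, with P = |T|.  Since T and T^* have the
   same kernel, so do the projections V^* V and V V^*, hence these are equal to
   one projection E.  Then P^2 = T T^* = V P^2 V^* shows that V commutes with
   P^2, hence with P, and U = V^2 + (1 - E) is a unitary with U T^* = T.

   That V commutes with the positive root P = S^* S as soon as it commutes with
   P^2 rests on Fukamiya's theorem: S^* S = - T^2 with T self-adjoint forces
   S = 0.  It is proved here inside L(X), from the norm of X alone: a unitary is
   isometric, so a self-adjoint operator with bounded powers is contractive,
   being the imaginary part of the unitary sqrt (1 - T^2) + i T. *)
Require Import Defs.
From HB Require Import structures.
From mathcomp Require Import all_boot all_order all_algebra.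
From mathcomp Require Import all_classical all_reals all_analysis.
From mathcomp Require Import complex ssrAC ring.

Set Implicit Arguments.
Unset Strict Implicit.
Unset Printing Implicit Defensive.
Import Order.TTheory GRing.Theory Num.Theory.
Import numFieldNormedType.Exports.
Local Open Scope classical_set_scope.
Local Open Scope complex_scope.
Local Open Scope ring_scope.

(** * Archimedean estimates and limits with an explicit rate *)

Lemma complex_archi (R : realType) (c e : R[i]) :
  0 <= c -> 0 < e -> exists n : nat, c < e * n%:R.
Proof.
move=> c0 e0.
have /complex_realP[c' cE] := ger0_real c0.
have /complex_realP[e' eE] := gtr0_real e0.
move: c0 e0; rewrite {}cE {}eE => c0 e0.
have e'0 : 0 < e' by rewrite -ltcR.
exists (Num.truncn (c' / e')).+1.
rewrite -[_%:R](rmorph_nat (real_complex R)) -rmorphM ltcR mulrC.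
rewrite -ltr_pdivrMr //.
exact: truncnS_gt.
Qed.

Lemma le_all_div (R : realType) (a b c : R[i]) : 0 <= a -> 0 <= b -> 0 <= c ->
  (forall n : nat, a <= b + c / n.+1%:R) -> a <= b.
Proof.
move=> a0 b0 c0 abc; apply/ler_addgt0Pr => e e0.
have [n cn] := complex_archi c0 e0.
apply: (le_trans (abc n)); rewrite lerD2l ler_pdivrMr ?ltr0Sn //.
by apply: (le_trans (ltW cn)); rewrite ler_pM2l // ler_nat.
Qed.

(** The limit keeps the explicit rate [b]; this serves both for nested balls and for limits of
    operators. *)
Lemma complete_cvg (R : realType) (X : completeNormedModType R[i])
    (x : nat -> X) (b : nat -> R[i]) (c : R[i]) : 0 <= c ->
  (forall n, b n <= c / n.+1%:R) ->
  (forall n m, (n <= m)%N -> `|x m - x n| <= b n) ->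
  exists l, forall n, `|l - x n| <= b n.
Proof.
move=> c0 bc xb.
have : cvg (x @ \oo).
  apply: cauchy_cvg; apply: cauchy_exP => e e0.
  have [n cn] := complex_archi c0 e0.
  exists (x n); exists n => // m /= nm.
  rewrite -ball_normE /ball_ /= distrC.
  apply: (le_lt_trans (xb _ _ nm)); apply: (le_lt_trans (bc n)).
  rewrite ltr_pdivrMr ?ltr0Sn //.
  by apply: (lt_le_trans cn); rewrite ler_pM2l // ler_nat.
move/cvg_ex => [l /= xl]; exists l => n.
apply/ler_addgt0Pr => e e0.
move/cvgrPdist_lt : xl => /(_ e e0) [N _ Nl].
have /= := Nl (maxn N n) (leq_maxl _ _).
move=> lt1; have := xb n (maxn N n) (leq_maxr _ _) => lt2.
rewrite -(subrK (x (maxn N n)) l) -addrA addrC.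
by apply: (le_trans (ler_normD _ _)); apply: lerD => //; exact: ltW.
Qed.

(** * Hilbert modules and their adjointable operators *)

Section InnerProduct.
Variables (R : realType) (A : cstarAlgType R) (X : hilbertModType A).
Implicit Types x y z : X.

Local Notation ip x y := (inner x y : A).

Lemma innerDl x y z : ip (x + y) z = ip x z + ip y z.
Proof. by rewrite inner_star innerDr cstarD -!inner_star. Qed.

Lemma innerZl (a : R[i]) x y : ip (a *: x) y = Num.conj a *: ip x y.
Proof. by rewrite inner_star innerZr cstarZ -inner_star. Qed.

Lemma inner0r x : ip x 0 = 0.
Proof. by rewrite -(scale0r (0 : X)) innerZr scale0r. Qed.

Lemma inner0l x : ip 0 x = 0.
Proof. by rewrite -(scale0r (0 : X)) innerZl rmorph0 scale0r. Qed.

Lemma innerBl x y z : ip (x - y) z = ip x z - ip y z.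
Proof. by rewrite -scaleN1r innerDl innerZl rmorphN1 scaleN1r. Qed.

Lemma norm_inner_sqr x : `|ip x x| = `|x| ^+ 2.
Proof. by rewrite norm_inner sqrtCK. Qed.

Lemma inner_sqrD x y :
  ip (x + y) (x + y) - ip (x - y) (x - y) = 2 *: (ip x y + ip y x).
Proof.
rewrite innerDl innerBl !innerBr !innerDr !opprD !opprK scaler_nat mulr2n.
rewrite [LHS](AC ((2*2)*(2*2)) ((2*3)*(6*7)*((1*5)*(4*8)))) /=.
by rewrite !subrr !addr0.
Qed.

(** Polarisation; the minus sign before ['i] reflects conjugate-linearity in the first variable. *)
Lemma inner_polar x y :
  4 *: ip x y = ip (x + y) (x + y) - ip (x - y) (x - y)
    - 'i *: (ip (x + 'i *: y) (x + 'i *: y) - ip (x - 'i *: y) (x - 'i *: y)).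
Proof.
rewrite !inner_sqrD innerZr innerZl conjCi scaleNr -scalerBr.
rewrite !scalerA mulrAC mulCii mulN1r scaleNr opprK -scalerDr.
rewrite addrACA subrr addr0 -[ip x y + _]mulr2n.
by rewrite -[ip x y *+ _]scaler_nat scalerA -natrM.
Qed.

Lemma norm_inner_sqr_le x y : `|ip x y| <= (`|x| + `|y|) ^+ 2.
Proof.
have le4 z : `|z| = `|y| ->
    `|ip (x + z) (x + z) - ip (x - z) (x - z)| <= 2 * (`|x| + `|y|) ^+ 2.
  move=> zy; apply: (le_trans (ler_normB _ _)).
  rewrite !norm_inner_sqr mulr_natl mulr2n.
  by apply: lerD; apply: lerXn2r; rewrite ?nnegrE ?addr_ge0 // -zy
    ?ler_normD ?ler_normB.
rewrite -(ler_pM2l (_ : 0 < 4)) // -[X in X * `|_| <= _]ger0_norm // -normrZ.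
rewrite inner_polar; apply: (le_trans (ler_normB _ _)).
rewrite normrZ normCi mul1r (_ : 4 = 2 + 2); last by rewrite -natrD.
rewrite mulrDl; apply: lerD; apply: le4 => //.
by rewrite normrZ normCi mul1r.
Qed.

(* The Cauchy-Schwarz inequality up to a constant: the sharp one needs the
   positive cone of A, whereas this one follows from polarisation. *)
Lemma norm_inner_le4 x y : `|ip x y| <= 4 * (`|x| * `|y|).
Proof.
have [->|x0] := eqVneq x 0; first by rewrite inner0l !normr0 mul0r mulr0.
have [->|y0] := eqVneq y 0; first by rewrite inner0r !normr0 !mulr0.
have xgt0 : 0 < `|x| by rewrite normr_gt0.
have ygt0 : 0 < `|y| by rewrite normr_gt0.
(* For unit vectors the bound is (1 + 1)^2 = 4; homogeneity gives the general case. *)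
have := norm_inner_sqr_le (`|x|^-1 *: x) (`|y|^-1 *: y).
rewrite innerZl innerZr conj_Creal ?rpredV ?normr_real // !normrZ.
rewrite !normfV !normr_id !mulVf ?gt_eqF // -mulr2n -natrX.
by rewrite !ler_pdivrMl // mulrA mulrC [X in 4 * X]mulrC.
Qed.

End InnerProduct.

Section AdjointableAlgebra.
Variables (R : realType) (A : cstarAlgType R) (X : hilbertModType A).
Local Notation L := (adjointable X).
Local Notation ip x y := (inner x y : A).
Implicit Types S T U V : L.

Lemma aopP T x y : ip (T x) y = ip x (adj T y).
Proof. exact: aop_adjP. Qed.

Lemma aopD T x y : T (x + y) = T x + T y.
Proof. by case: (aop_linear T). Qed.

Lemma aopZ T (a : R[i]) x : T (a *: x) = a *: T x.
Proof. by case: (aop_linear T). Qed.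

Lemma aopB T x y : T (x - y) = T x - T y.
Proof. by rewrite aopD -scaleN1r aopZ scaleN1r. Qed.

Lemma aop0 T : T 0 = 0.
Proof. by have := aopB T 0 0; rewrite !subrr. Qed.

(** The adjoint is determined by the operator and the other fields are proofs. Equality of records
    is what lets L(X) be used as a ring. *)
Lemma adjointable_eq S T : S =1 T -> S = T.
Proof.
move: S T => [f f' lf ff'] [g g' lg gg'] /= fg.
have {}fg : f = g by apply/funext.
move: lf ff'; rewrite fg => lf ff'.
have f'g' : f' = g' by apply/funext; exact: is_adjoint_unique ff' gg'.
move: ff'; rewrite f'g' => ff'.
by rewrite (Prop_irrelevance lf lg) (Prop_irrelevance ff' gg').
Qed.

Definition mk_adjointable (f g : X -> X) (fg : is_adjoint f g) : L :=
  Adjointable (is_adjoint_linear (is_adjoint_sym fg)) fg.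

Fact is_adjoint0 : is_adjoint (fun _ : X => 0) (fun _ => 0).
Proof. by move=> x y; rewrite inner0l inner0r. Qed.

Fact is_adjoint1 : is_adjoint (@id X) id.
Proof. by []. Qed.

Fact is_adjointN T : is_adjoint (fun x => - T x) (fun x => - adj T x).
Proof.
move=> x y; rewrite -(scaleN1r (T x)) -(scaleN1r (adj T y)).
by rewrite innerZl innerZr aopP rmorphN1.
Qed.

Fact is_adjointD S T :
  is_adjoint (fun x => S x + T x) (fun x => adj S x + adj T x).
Proof. by move=> x y; rewrite innerDl innerDr !aopP. Qed.

Fact is_adjointZ (a : R[i]) T :
  is_adjoint (fun x => a *: T x) (fun x => Num.conj a *: adj T x).
Proof. by move=> x y; rewrite innerZl innerZr aopP. Qed.

Fact is_adjointM S T :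
  is_adjoint (fun x => S (T x)) (fun x => adj T (adj S x)).
Proof. by move=> x y; rewrite !aopP. Qed.

HB.instance Definition _ := gen_eqMixin L.
HB.instance Definition _ := gen_choiceMixin L.

Definition adjointable0 := mk_adjointable is_adjoint0.
Definition adjointable1 := mk_adjointable is_adjoint1.
Definition adjointableN T := mk_adjointable (is_adjointN T).
Definition adjointableD S T := mk_adjointable (is_adjointD S T).
Definition adjointableZ a T := mk_adjointable (is_adjointZ a T).
Definition adjointableM S T := mk_adjointable (is_adjointM S T).

Fact adjointable_addA : associative adjointableD.
Proof. by move=> S T U; apply: adjointable_eq => x /=; rewrite addrA. Qed.
Fact adjointable_addC : commutative adjointableD.
Proof. by move=> S T; apply: adjointable_eq => x /=; rewrite addrC. Qed.
Fact adjointable_add0 : left_id adjointable0 adjointableD.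
Proof. by move=> S; apply: adjointable_eq => x /=; rewrite add0r. Qed.
Fact adjointable_addN : left_inverse adjointable0 adjointableN adjointableD.
Proof. by move=> S; apply: adjointable_eq => x /=; rewrite addNr. Qed.

HB.instance Definition _ := GRing.isZmodule.Build L adjointable_addA
  adjointable_addC adjointable_add0 adjointable_addN.

Fact adjointable_mulA : associative adjointableM.
Proof. by move=> S T U; apply: adjointable_eq. Qed.
Fact adjointable_mul1l : left_id adjointable1 adjointableM.
Proof. by move=> S; apply: adjointable_eq. Qed.
Fact adjointable_mul1r : right_id adjointable1 adjointableM.
Proof. by move=> S; apply: adjointable_eq. Qed.
Fact adjointable_mulDl : left_distributive adjointableM +%R.
Proof. by move=> S T U; apply: adjointable_eq. Qed.
Fact adjointable_mulDr : right_distributive adjointableM +%R.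
Proof. by move=> S T U; apply: adjointable_eq => x /=; rewrite aopD. Qed.

HB.instance Definition _ := GRing.Zmodule_isPzRing.Build L adjointable_mulA
  adjointable_mul1l adjointable_mul1r adjointable_mulDl adjointable_mulDr.

Fact adjointable_scaleA a b T :
  adjointableZ a (adjointableZ b T) = adjointableZ (a * b) T.
Proof. by apply: adjointable_eq => x /=; rewrite scalerA. Qed.
Fact adjointable_scale1 : left_id 1 adjointableZ.
Proof. by move=> T; apply: adjointable_eq => x /=; rewrite scale1r. Qed.
Fact adjointable_scaleDr : right_distributive adjointableZ +%R.
Proof. by move=> a S T; apply: adjointable_eq => x /=; rewrite scalerDr. Qed.
Fact adjointable_scaleDl T :
  {morph adjointableZ^~ T : a b / a + b >-> a + b}.
Proof. by move=> a b; apply: adjointable_eq => x /=; rewrite scalerDl. Qed.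

HB.instance Definition _ := GRing.Zmodule_isLmodule.Build R[i] L
  adjointable_scaleA adjointable_scale1 adjointable_scaleDr
  adjointable_scaleDl.

Lemma aop_addE S T x : (S + T) x = S x + T x. Proof. by []. Qed.
Lemma aop_oppE T x : (- T) x = - T x. Proof. by []. Qed.
Lemma aop_mulE S T x : (S * T) x = S (T x). Proof. by []. Qed.
Lemma aop_scaleE a T x : (a *: T) x = a *: T x. Proof. by []. Qed.
Lemma aop_0E x : (0 : L) x = 0. Proof. by []. Qed.
Lemma aop_1E x : (1 : L) x = x. Proof. by []. Qed.
Definition aopE := (aop_addE, aop_oppE, aop_mulE, aop_scaleE, aop_0E, aop_1E).

Lemma scale_mull (a : R[i]) S T : (a *: S) * T = a *: (S * T).
Proof. exact: adjointable_eq. Qed.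

Lemma scale_mulr (a : R[i]) S T : S * (a *: T) = a *: (S * T).
Proof. by apply: adjointable_eq => x; rewrite !aopE aopZ. Qed.

Lemma adjK T : adj (adj T) = T. Proof. exact: adjointable_eq. Qed.
Lemma adjD S T : adj (S + T) = adj S + adj T.
Proof. exact: adjointable_eq. Qed.
Lemma adjN T : adj (- T) = - adj T. Proof. exact: adjointable_eq. Qed.
Lemma adjM S T : adj (S * T) = adj T * adj S.
Proof. exact: adjointable_eq. Qed.
Lemma adjZ a T : adj (a *: T) = Num.conj a *: adj T.
Proof. exact: adjointable_eq. Qed.
Lemma adj1 : adj (1 : L) = 1. Proof. exact: adjointable_eq. Qed.

Lemma adjX T n : adj (T ^+ n) = adj T ^+ n.
Proof. by elim: n => [|n IH]; rewrite ?adj1 // exprS adjM IH exprSr. Qed.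

Lemma adj_mul_eq0 T : adj T * T = 0 -> T = 0.
Proof.
move=> TT; apply: adjointable_eq => x; apply: (@inner_eq0 _ _ X).
by rewrite aopP -aop_mulE TT inner0r.
Qed.

Lemma selfadjoint_sqr_eq0 T : adj T = T -> T ^+ 2 = 0 -> T = 0.
Proof. by move=> sT T0; apply: adj_mul_eq0; rewrite sT. Qed.

(** A bound on the operator norm, stated pointwise to avoid a supremum. *)
Definition op_le T (M : R[i]) : Prop := forall x, `|T x| <= M * `|x|.

Lemma op_leD S T M N : op_le S M -> op_le T N -> op_le (S + T) (M + N).
Proof.
move=> SM TN x; rewrite aopE mulrDl.
by apply: (le_trans (ler_normD _ _)); apply: lerD.
Qed.

Lemma op_leN T M : op_le T M -> op_le (- T) M.
Proof. by move=> TM x; rewrite aopE normrN. Qed.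

Lemma op_leB S T M N : op_le S M -> op_le T N -> op_le (S - T) (M + N).
Proof. by move=> SM TN; apply: op_leD => //; exact: op_leN. Qed.

Lemma op_leM S T M N :
  0 <= M -> op_le S M -> op_le T N -> op_le (S * T) (M * N).
Proof.
move=> M0 SM TN x; rewrite aopE -mulrA.
by apply: (le_trans (SM _)); apply: ler_wpM2l.
Qed.

Lemma op_leZ a T M : op_le T M -> op_le (a *: T) (`|a| * M).
Proof. by move=> TM x; rewrite aopE normrZ -mulrA ler_wpM2l. Qed.

Lemma op_le1 : op_le 1 1.
Proof. by move=> x; rewrite mul1r. Qed.

Lemma op_le0 : op_le 0 0.
Proof. by move=> x; rewrite aopE normr0 mul0r. Qed.

Lemma op_leW T M N : M <= N -> op_le T M -> op_le T N.
Proof. by move=> MN TM x; apply: (le_trans (TM x)); rewrite ler_wpM2r. Qed.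

Lemma op_leX T M n : 0 <= M -> op_le T M -> op_le (T ^+ n) (M ^+ n).
Proof.
move=> M0 TM; elim: n => [|n IH]; first exact: op_le1.
by rewrite !exprS; apply: op_leM.
Qed.

Lemma op_le_eq0 T : op_le T 0 -> T = 0.
Proof.
move=> T0; apply: adjointable_eq => x; apply/eqP; rewrite aopE -normr_le0.
by have := T0 x; rewrite mul0r.
Qed.

Lemma isometry_norm T : adj T * T = 1 -> forall x, `|T x| = `|x|.
Proof.
move=> TT x; apply/eqP; rewrite -(@eqrXn2 _ 2) // -!norm_inner_sqr.
by rewrite aopP -aop_mulE TT.
Qed.

End AdjointableAlgebra.

(** * Automatic boundedness of adjointable operators *)

Section Boundedness.
Variables (R : realType) (A : cstarAlgType R) (X : hilbertModType A).
Local Notation L := (adjointable X).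
Local Notation ip x y := (inner x y : A).
Implicit Types S T U V : L.

(** Scaling gives [w] of norm [r] with T w large, and 2 T w = T (x + w) - T (x - w) makes one of the
    two values large. *)
Lemma aop_large_near T x (r M : R[i]) : (forall N, 0 <= N -> ~ op_le T N) ->
  0 < r -> 0 < M -> exists2 y, `|y - x| <= r & M <= `|T y|.
Proof.
move=> Tunb r0 M0.
have [z Tz] : exists z, M / r * `|z| < `|T z|.
  apply: contrapT => /forallNP noz; apply: (Tunb (M / r)).
    by rewrite divr_ge0 // ltW.
  move=> z; have /negP := noz z.
  by rewrite -real_leNgt ?normr_real ?rpredM ?rpredV ?normr_real ?gtr0_real.
have z0 : 0 < `|z|.
  rewrite normr_gt0; apply: contraTneq Tz => ->.
  by rewrite aop0 !normr0 mulr0 ltxx.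
pose w := (r / `|z|) *: z.
have rz0 : 0 <= r / `|z| by rewrite divr_ge0 // ltW.
have wr : `|w| = r by rewrite normrZ ger0_norm // divfK // gt_eqF.
have Tw : M <= `|T w|.
  rewrite aopZ normrZ ger0_norm //; apply: ltW.
  move: Tz; rewrite mulrAC ltr_pdivrMr // => Tz.
  by rewrite mulrAC ltr_pdivlMr // [r * _]mulrC.
have [Mx|] := boolP (M <= `|T (x + w)|).
  by exists (x + w) => //; rewrite addrAC subrr add0r wr.
rewrite -real_ltNge ?normr_real ?gtr0_real // => Tx.
exists (x - w); first by rewrite addrAC subrr add0r normrN wr.
have : 2 * M <= `|T (x + w)| + `|T (x - w)|.
  apply: le_trans (ler_normB _ _); rewrite -aopB.
  rewrite (_ : x + w - _ = 2 *: w); last first.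
    by rewrite opprB addrC addrA subrK scaler_nat mulr2n.
  by rewrite aopZ normrZ ger0_norm ?ler_wpM2l.
rewrite mulr_natl mulr2n => /le_trans /(_ (lerD (ltW Tx) (lexx _))).
by rewrite lerD2l.
Qed.

(** The map u |-> <T y, T u> = <T^* T y, u> is continuous whether or not T is, so |T u| stays large
    for u near y. *)
Lemma aop_ball_large T x (r : R[i]) n : (forall N, 0 <= N -> ~ op_le T N) ->
  0 < r -> exists yr : X * R[i], [/\ 0 < yr.2, `|yr.1 - x| <= r / 2,
    yr.2 <= r / 2 & forall u, `|u - yr.1| <= yr.2 -> n%:R <= `|T u|].
Proof.
move=> Tunb r0.
have r20 : 0 < r / 2 by rewrite divr_gt0.
(* The estimate below, t^2 / 2 <= 4 t |T u|, loses a factor 8; the successor makes t positive. *)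
have [y yx Ty] := aop_large_near x Tunb r20 (ltr0Sn R[i] (8 * n)).
pose t := `|T y|; pose a := r / 2.
have t0 : 0 < t by apply: lt_le_trans Ty.
pose d := 4 * `|adj T (T y)| + 1.
have d0 : 0 < d by rewrite ltr_wpDl // mulr_ge0.
pose b := t ^+ 2 / 2 / d.
have b0 : 0 < b by rewrite !divr_gt0 // exprn_gt0.
have ab0 : 0 < a + b by rewrite addr_gt0.
(* This radius is positive and below both [a] and [b]. *)
exists (y, a * b / (a + b)); split => //=.
- by rewrite divr_gt0 // mulr_gt0.
- by rewrite ler_pdivrMr // ler_pM2l // lerDr ltW.
move=> u; set s := _ / _ => us.
have sb : s <= b by rewrite ler_pdivrMr // mulrC ler_pM2l // lerDl ltW.
have : t ^+ 2 <= `|ip (T y) (T u)| + `|ip (adj T (T y)) (u - y)|.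
  rewrite -norm_inner_sqr; apply: le_trans (ler_normB _ _).
  by rewrite (aopP (adj T)) adjK aopB innerBr opprB addrC subrK.
have small : `|ip (adj T (T y)) (u - y)| <= t ^+ 2 / 2.
  apply: (le_trans (norm_inner_le4 _ _)); rewrite mulrA.
  apply: (@le_trans _ _ (d * b)).
    apply: ler_pM => //; first by rewrite lerDl.
    exact: le_trans us sb.
  by rewrite mulrC divfK // gt_eqF.
move=> /le_trans /(_ (lerD (norm_inner_le4 _ _) small)).
rewrite -lerBlDr -[X in X - _]mulr1 -mulrBr.
rewrite (_ : 1 - 2^-1 = 2^-1); last by rewrite {1}[1](splitr 1) mul1r addrK.
rewrite -/t ler_pdivrMr // expr2 [4 * _]mulrCA -mulrA ler_pM2l //.
move=> tT; have := le_trans Ty tT.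
rewrite mulrAC -natrM => /(le_trans (_ : 8 * n%:R <= _)).
by rewrite ler_pM2l // => -> //; rewrite -natrM ler_nat leqnSn.
Qed.

(* Hellinger-Toeplitz: otherwise nested balls, on the n-th of which T is at
   least n, would have a common point. *)
Lemma adjointable_bounded T : exists2 M, 0 <= M & op_le T M.
Proof.
apply: contrapT => noM.
have Tunb N : 0 <= N -> ~ op_le T N by move=> N0 TN; apply: noM; exists N.
(* The new centre is within half the old radius and the new radius is at most that half, so the
   balls are nested. *)
have step (p : nat * (X * {r : R[i] | 0 < r})) :
    exists q : X * {r : R[i] | 0 < r},
      [/\ `|q.1 - p.2.1| <= sval p.2.2 / 2, sval q.2 <= sval p.2.2 / 2
        & forall u, `|u - q.1| <= sval q.2 -> p.1%:R <= `|T u|].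
  case: p => n [x [r r0]] /=.
  have [[y s] [/= s0 yx sr sT]] := aop_ball_large x n Tunb r0.
  by exists (y, exist _ s s0).
have [f fP] := choice step.
pose xr := fix xr n := if n is m.+1 then f (m, xr m)
  else (0, exist _ 1 ltr01 : {r : R[i] | 0 < r}).
pose x n := (xr n).1; pose r n := sval (xr n).2.
have r_gt0 n : 0 < r n by rewrite /r; case: (xr n).2.
have xS n : `|x n.+1 - x n| <= r n / 2 by case: (fP (n, xr n)).
have rS n : r n.+1 <= r n / 2 by case: (fP (n, xr n)).
have Tx n u : `|u - x n.+1| <= r n.+1 -> n%:R <= `|T u|.
  by case: (fP (n, xr n)) => _ _; apply.
have rle n : r n <= 1 / n.+1%:R.
  rewrite ler_pdivlMr ?ltr0Sn //.
  apply: (@le_trans _ _ (r n * (2 ^ n)%:R)).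
    by rewrite ler_pM2l // ler_nat ltn_expl.
  elim: n => [|n IH]; first by rewrite expn0 mulr1.
  apply: le_trans IH; rewrite expnS natrM mulrA ler_wpM2r //.
  by rewrite -ler_pdivlMr.
(* Telescoping: |x_(n+1) - x_n| <= r_n / 2 <= r_n - r_(n+1). *)
have xB n m : (n <= m)%N -> `|x m - x n| <= r n - r m.
  move/subnK <-; elim: (m - n)%N => [|k IH]; first by rewrite !subrr normr0.
  rewrite addSn -[_ - x n](subrKA (x (k + n)%N)).
  apply: (le_trans (ler_normD _ _)).
  rewrite addrC -[leRHS](subrKA (r (k + n)%N)); apply: lerD => //.
  apply: (le_trans (xS _)); rewrite lerBrDr addrC -lerBrDr.
  apply: (le_trans (rS _)).
  by rewrite {2}[r (k + n)%N]splitr addrK.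
have xr' n m : (n <= m)%N -> `|x m - x n| <= r n.
  move=> nm; apply: (le_trans (xB _ _ nm)).
  by rewrite lerBlDr lerDl ltW.
have [l lx] := complete_cvg ler01 rle xr'.
(* [n] exceeds |T l|, yet [l] lies in ball n + 1, on which T is at least n. *)
have [n] := complex_archi (normr_ge0 (T l)) ltr01.
rewrite mul1r => /le_lt_trans /= Tl.
by have := Tl _ (Tx n l (lx n.+1)); rewrite ltxx.
Qed.

End Boundedness.

(** * Square roots *)

Section SquareRoot.
Variables (R : realType) (A : cstarAlgType R) (X : hilbertModType A).
Local Notation L := (adjointable X).
Local Notation ip x y := (inner x y : A).
Implicit Types S T U V W z : L.

Lemma op_le_lim T M c : 0 <= M -> 0 <= c ->
  (forall n : nat, op_le T (M + c / n.+1%:R)) -> op_le T M.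
Proof.
move=> M0 c0 TM x; apply: (@le_all_div _ _ _ (c * `|x|)); rewrite ?mulr_ge0 //.
by move=> n; rewrite mulrAC -mulrDl; exact: TM.
Qed.

Lemma op_le_lim_eq0 T c : 0 <= c ->
  (forall n : nat, op_le T (c / n.+1%:R)) -> T = 0.
Proof.
move=> c0 Tc; apply: op_le_eq0; apply: (@op_le_lim _ 0 c) => // n.
by rewrite add0r.
Qed.

(* [ncomb z W c] means that W is a polynomial in z with nonnegative
   coefficients of sum c, so that |W| <= c sup_n |z^n|. *)
Inductive ncomb z : L -> R[i] -> Prop :=
| ncombX n : ncomb z (z ^+ n) 1
| ncombD V W a b : ncomb z V a -> ncomb z W b -> ncomb z (V + W) (a + b)
| ncombZ (k : R[i]) W a : 0 <= k -> ncomb z W a -> ncomb z (k *: W) (k * a).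

Lemma ncomb0 z : ncomb z 0 0.
Proof. by have := ncombZ (lexx 0) (ncombX z 0); rewrite scale0r mul0r. Qed.

Lemma ncomb_ge0 z W a : ncomb z W a -> 0 <= a.
Proof.
elim=> [n|V W' b c _ b0 _ c0|k W' b k0 _ b0]; first exact: ler01.
  exact: addr_ge0.
exact: mulr_ge0.
Qed.

Lemma ncomb_op_le z C W a : 0 <= C -> (forall n, op_le (z ^+ n) C) ->
  ncomb z W a -> op_le W (C * a).
Proof.
move=> C0 zC; elim=> [n|V W' b c _ b0 _ c0|k W' b k0 _ b0].
- by rewrite mulr1.
- by rewrite mulrDr; apply: op_leD.
- by rewrite mulrCA -{2}(ger0_norm k0); apply: op_leZ.
Qed.

Lemma ncombM z V W a b : ncomb z V a -> ncomb z W b -> ncomb z (V * W) (a * b).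
Proof.
move=> Va Wb; elim: Va => [n|V1 V2 c d _ IH1 _ IH2|k V1 c k0 _ IH].
- rewrite mul1r; elim: Wb => [m|W1 W2 c d _ IH1 _ IH2|k W1 c k0 _ IH].
  + by rewrite -exprD; apply: ncombX.
  + by rewrite mulrDr; apply: ncombD.
  + by rewrite scale_mulr; apply: ncombZ.
- by rewrite !mulrDl; apply: ncombD.
- by rewrite scale_mull -mulrA; apply: ncombZ.
Qed.

Lemma ncomb_adj z W a : adj z = z -> ncomb z W a -> adj W = W.
Proof.
move=> sz; elim=> [n|V1 V2 c d _ IH1 _ IH2|k V1 c k0 _ IH].
- by rewrite adjX sz.
- by rewrite adjD IH1 IH2.
- by rewrite adjZ geC0_conj // IH.
Qed.

Lemma ncomb_comm z W a T : GRing.comm T z -> ncomb z W a -> GRing.comm T W.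
Proof.
move=> Tz; elim=> [n|V1 V2 c d _ IH1 _ IH2|k V1 c k0 _ IH].
- exact: commrX.
- exact: commrD.
- by rewrite /GRing.comm scale_mulr scale_mull IH.
Qed.

Fixpoint sqrt_iter z n : L :=
  if n is m.+1 then 2^-1 *: (z + sqrt_iter z m ^+ 2) else 0.

(** The same iteration at z = 1: the coefficient sum of [sqrt_iter z n] as a polynomial in z. *)
Fixpoint sqrt_iter_coef n : R[i] :=
  if n is m.+1 then 2^-1 * (1 + sqrt_iter_coef m ^+ 2) else 0.

Lemma sqrt_iter_ncomb z n : ncomb z (sqrt_iter z n) (sqrt_iter_coef n).
Proof.
elim: n => [|n IH] /=; first exact: ncomb0.
apply: ncombZ; first by rewrite invr_ge0.
by apply: ncombD; [exact: (ncombX z 1) | exact: ncombM].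
Qed.

Lemma sqrt_iter_comm z m n : GRing.comm (sqrt_iter z m) (sqrt_iter z n).
Proof.
apply: (ncomb_comm _ (sqrt_iter_ncomb z n)); apply: commr_sym.
exact: (ncomb_comm _ (sqrt_iter_ncomb z m)).
Qed.

Lemma subr_sqr_comm S T : GRing.comm S T -> S ^+ 2 - T ^+ 2 = (S - T) * (S + T).
Proof. by move=> ST; rewrite mulrDr !mulrBl -ST addrA subrK. Qed.

(** w_(n+2) - w_(n+1) = (w_(n+1) - w_n) (w_(n+1) + w_n) / 2, so nonnegativity of the coefficients
    propagates. *)
Lemma sqrt_iterS_ncomb z n :
  ncomb z (sqrt_iter z n.+1 - sqrt_iter z n)
    (sqrt_iter_coef n.+1 - sqrt_iter_coef n).
Proof.
elim: n => [|n IH].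
  rewrite /= !expr0n /= !addr0 !subr0.
  by apply: ncombZ; [rewrite invr_ge0 | exact: (ncombX z 1)].
have SE : forall m, sqrt_iter z m.+1 = 2^-1 *: (z + sqrt_iter z m ^+ 2) by [].
have cE : forall m, sqrt_iter_coef m.+1 = 2^-1 * (1 + sqrt_iter_coef m ^+ 2).
  by [].
rewrite SE [in X in _ - X]SE -scalerBr opprD addrACA subrr add0r.
rewrite cE [in X in ncomb _ _ (_ - X)]cE -mulrBr opprD addrACA subrr add0r.
apply: ncombZ; first by rewrite invr_ge0.
rewrite subr_sqr_comm; last exact: (sqrt_iter_comm z n.+1 n).
rewrite subr_sqr.
by apply: ncombM => //; apply: ncombD; exact: sqrt_iter_ncomb.
Qed.

Lemma sqrt_iterB_ncomb z m n : (n <= m)%N ->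
  ncomb z (sqrt_iter z m - sqrt_iter z n)
    (sqrt_iter_coef m - sqrt_iter_coef n).
Proof.
move/subnK <-; elim: (m - n)%N => [|k IH].
  by rewrite !subrr; exact: ncomb0.
rewrite addSn -(subrKA (sqrt_iter z (k + n)) (sqrt_iter z _)).
rewrite -(subrKA (sqrt_iter_coef (k + n)) (sqrt_iter_coef _)).
by apply: ncombD => //; exact: sqrt_iterS_ncomb.
Qed.

Lemma sqrt_iter_coef_ge0 n : 0 <= sqrt_iter_coef n.
Proof. exact: ncomb_ge0 (sqrt_iter_ncomb 0 n). Qed.

Lemma sqrt_iter_coef_le1 n : sqrt_iter_coef n <= 1.
Proof.
elim: n => [|n IH] //=; rewrite ler_pdivrMl // mulr1 -[leRHS]/(1 + 1) lerD2l.
by rewrite expr_le1 ?sqrt_iter_coef_ge0.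
Qed.

Lemma sqrt_iter_coef_cvg n : 1 - sqrt_iter_coef n <= 2 / n.+1%:R.
Proof.
rewrite ler_pdivlMr ?ltr0Sn //.
(* The induction runs on the stronger e (n + 2) <= 2, the next error being e - e^2 / 2. *)
apply: (@le_trans _ _ ((1 - sqrt_iter_coef n) * n.+2%:R)).
  by rewrite ler_wpM2l ?ler_nat // subr_ge0 sqrt_iter_coef_le1.
elim: n => [|n IH]; first by rewrite subr0 mul1r.
move: IH; set e := 1 - sqrt_iter_coef n => IH.
have e1 : e <= 1 by rewrite gerBl sqrt_iter_coef_ge0.
have e0 : 0 <= e by rewrite subr_ge0 sqrt_iter_coef_le1.
have -> : (1 - sqrt_iter_coef n.+1) * n.+3%:R =
    2 - (2 - e * n.+2%:R) * (1 - e / 2) - e ^+ 2 / 2.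
  have -> : n.+3%:R = n%:R + 3 :> R[i] by rewrite -natrD addn3.
  have -> : n.+2%:R = n%:R + 2 :> R[i] by rewrite -natrD addn2.
  by rewrite /= /e; field.
rewrite -addrA -opprD gerBl addr_ge0 //.
  rewrite mulr_ge0 // subr_ge0 // ler_pdivrMr // mul1r (le_trans e1) //.
  by rewrite ler1n.
by rewrite divr_ge0 // exprn_ge0.
Qed.

(** The limit is taken at each vector. Self-adjointness passes to it by the Cauchy-Schwarz bound,
    and linearity follows from having an adjoint. *)
Lemma pointwise_limit (w : nat -> L) (c : R[i]) : 0 <= c ->
  (forall n, adj (w n) = w n) ->
  (forall n m, (n <= m)%N -> op_le (w m - w n) (c / n.+1%:R)) ->
  exists2 W, adj W = W & forall n, op_le (W - w n) (c / n.+1%:R).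
Proof.
move=> c0 sw wc.
have /choice [f fP] : forall x, exists l,
    forall n, `|l - w n x| <= c * `|x| / n.+1%:R.
  move=> x; apply: (@complete_cvg _ _ (fun n => w n x) _ (c * `|x|)) => //.
    by rewrite mulr_ge0.
  by move=> n m nm; rewrite mulrAC; exact: wc.
have ff : is_adjoint f f.
  move=> x y; apply/eqP; rewrite -subr_eq0 -normr_le0.
  (* 8 = 4 + 4: one Cauchy-Schwarz constant for each of the two error terms. *)
  apply: (@le_all_div _ _ _ (8 * c * `|x| * `|y|)); rewrite ?mulr_ge0 //.
  move=> n; rewrite add0r.
  have -> : ip (f x) y - ip x (f y) =
      ip (f x - w n x) y - ip x (f y - w n y).
    by rewrite innerBl innerBr aopP sw opprB addrA subrK.
  apply: (le_trans (ler_normB _ _)).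
  apply: (le_trans (lerD (norm_inner_le4 _ _) (norm_inner_le4 _ _))).
  rewrite -mulrDr.
  have := lerD (ler_wpM2r (normr_ge0 y) (fP x n))
    (ler_wpM2l (normr_ge0 x) (fP y n)).
  rewrite -(ler_pM2l (_ : 0 < 4)) // => /le_trans; apply.
  by rewrite le_eqVlt; apply/orP; left; apply/eqP; field.
exists (mk_adjointable ff); first exact: adjointable_eq.
by move=> n x; rewrite mulrAC; exact: fP.
Qed.

(* The binomial series of 1 - sqrt (1 - z), as the limit of the iteration
   w |-> (z + w ^ 2) / 2: its coefficients are nonnegative of sum 1, so it
   converges as soon as the powers of z are bounded. *)
Lemma sqrt_one_sub z (C : R[i]) : 0 <= C -> adj z = z ->
  (forall n, op_le (z ^+ n) C) ->
  exists w, [/\ adj w = w, (1 - w) ^+ 2 = 1 - z,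
    forall T, GRing.comm T z -> GRing.comm T w & forall n, op_le (w ^+ n) C].
Proof.
move=> C0 sz zC; pose wn := sqrt_iter z.
have sw n : adj (wn n) = wn n by apply: ncomb_adj (sqrt_iter_ncomb z n).
have wnC k n : op_le (wn n ^+ k) C.
  apply: (@op_leW _ _ _ _ (C * sqrt_iter_coef n ^+ k)).
    rewrite -[leRHS]mulr1 ler_wpM2l // exprn_ile1 ?sqrt_iter_coef_ge0 //.
    exact: sqrt_iter_coef_le1.
  apply: ncomb_op_le => //; elim: k => [|k IH].
    by rewrite !expr0; exact: (ncombX z 0).
  by rewrite !exprS; apply: ncombM => //; exact: sqrt_iter_ncomb.
have c0 : 0 <= C * 2 by rewrite mulr_ge0.
have wcauchy n m : (n <= m)%N -> op_le (wn m - wn n) (C * 2 / n.+1%:R).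
  move=> nm; apply: op_leW (ncomb_op_le C0 zC (sqrt_iterB_ncomb z nm)).
  rewrite -mulrA ler_wpM2l //; apply: le_trans (sqrt_iter_coef_cvg n).
  by rewrite lerD2r sqrt_iter_coef_le1.
have [w adjw wlim] := pointwise_limit c0 sw wcauchy.
have [M M0 wM] := adjointable_bounded w.
exists w; split => //.
(* The fixed-point equation is (1 - w)^2 = 1 - z rearranged; its defect is shown to be O(1/n). *)
- suff wE : w - 2^-1 *: (z + w ^+ 2) = 0.
    have /(congr1 (fun T => 2 *: T)) : w = 2^-1 *: (z + w ^+ 2).
      by apply/eqP; rewrite -subr_eq0 wE.
    rewrite scalerA divff ?pnatr_eq0 // scale1r scaler_nat => wz.
    rewrite expr2 mulrBl mul1r mulrBr mulr1 opprB -addrA.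
    have -> : z = w *+ 2 - w * w by rewrite wz addrK.
    by rewrite opprB mulr2n opprD [- w + _]addrCA.
  have k0 : 0 <= C * 2 + 2^-1 * (C * (C * 2) + C * 2 * M).
    by rewrite !(addr_ge0, mulr_ge0) // ?invr_ge0.
  apply: (op_le_lim_eq0 k0) => n.
  have -> : w - 2^-1 *: (z + w ^+ 2) =
     (w - wn n.+1) - 2^-1 *: (wn n * (w - wn n) + (w - wn n) * w).
    have -> : wn n * (w - wn n) + (w - wn n) * w = w ^+ 2 - wn n ^+ 2.
      by rewrite mulrBr mulrBl addrC addrA subrK.
    rewrite [wn n.+1]/= -addrA -opprD -scalerDr.
    by rewrite -addrA [sqrt_iter z n ^+ 2 + _]addrC subrK.
  rewrite [X in op_le _ X]mulrDl; apply: op_leB.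
    apply: op_leW (wlim _); rewrite ler_wpM2l //.
    by rewrite lef_pV2 ?posrE ?ltr0Sn // ler_nat.
  rewrite -[X in op_le _ X]mulrA.
  rewrite -[X in op_le _ (X * _)](@ger0_norm _ 2^-1) ?invr_ge0 //.
  apply: op_leZ.
  have -> : (C * (C * 2) + C * 2 * M) / n.+1%:R =
      C * (C * 2 / n.+1%:R) + C * 2 / n.+1%:R * M.
    by field.
  apply: op_leD.
    by apply: op_leM => //; exact: (wnC 1%N n).
  by apply: op_leM => //; rewrite divr_ge0.
(* T commutes with each iterate, a polynomial in z, so its commutator with w is O(1/n). *)
- move=> T Tz; have [N N0 TN] := adjointable_bounded T.
  apply/eqP; rewrite -subr_eq0; apply/eqP.
  apply: (@op_le_lim_eq0 _ (N * (C * 2) + C * 2 * N)).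
    by rewrite addr_ge0 // mulr_ge0.
  move=> n.
  have Twn : GRing.comm T (wn n) := ncomb_comm Tz (sqrt_iter_ncomb z n).
  have -> : T * w - w * T = T * (w - wn n) - (w - wn n) * T.
    by rewrite mulrBr mulrBl -Twn opprB addrA subrK.
  have -> : (N * (C * 2) + C * 2 * N) / n.+1%:R =
      N * (C * 2 / n.+1%:R) + C * 2 / n.+1%:R * N.
    by field.
  apply: op_leB; apply: op_leM => //.
  by rewrite divr_ge0.
- move=> k.
  (* For each fixed exponent the powers of the iterates converge at rate 1/n, so the bound [C]
     passes to w^k. *)
  have [K K0 wK] : exists2 K, 0 <= K &
      forall n, op_le (w ^+ k - wn n ^+ k) (K / n.+1%:R).
    elim: k => [|k [K K0 IH]].
      by exists 0 => // n; rewrite subrr mul0r; exact: op_le0.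
    exists (M * K + C * 2 * C); first by rewrite addr_ge0 // !mulr_ge0.
    move=> n.
    have -> : w ^+ k.+1 - wn n ^+ k.+1 =
        w * (w ^+ k - wn n ^+ k) + (w - wn n) * wn n ^+ k.
      by rewrite !exprS mulrBr mulrBl addrA subrK.
    have -> : (M * K + C * 2 * C) / n.+1%:R =
      M * (K / n.+1%:R) + C * 2 / n.+1%:R * C.
    by field.
    apply: op_leD; apply: op_leM => //.
    by rewrite divr_ge0.
  apply: (op_le_lim C0 K0) => n; rewrite -[w ^+ k](subrK (wn n ^+ k)) addrC.
  exact: op_leD.
Qed.

End SquareRoot.

(** * Self-adjoint operators and squares *)

Section PositiveOperators.
Variables (R : realType) (A : cstarAlgType R) (X : hilbertModType A).
Local Notation L := (adjointable X).
Implicit Types S T U V W : L.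

Lemma op_leX1 T n : op_le T 1 -> op_le (T ^+ n) 1.
Proof. by move=> T1; have := op_leX n ler01 T1; rewrite expr1n. Qed.

Lemma scale_halfD T : 2^-1 *: (T + T) = T.
Proof.
have -> : T + T = 2 *: T by rewrite scaler_nat mulr2n.
by rewrite scalerA mulVf ?pnatr_eq0 // scale1r.
Qed.

Lemma op_le_half S T : op_le S 1 -> op_le T 1 -> op_le (2^-1 *: (S + T)) 1.
Proof.
move=> S1 T1; have half : `|2^-1| * (1 + 1) = 1 :> R[i].
  by rewrite ger0_norm ?invr_ge0 // mulVf // pnatr_eq0.
by rewrite -[X in op_le _ X]half; apply: op_leZ; apply: op_leD.
Qed.

(** U = Y + i T, where Y = sqrt (1 - T^2) commutes with T; hence U^* U = U U^* = Y^2 + T^2 = 1. *)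
Lemma unitary_dilation T (C : R[i]) : 0 <= C -> adj T = T ->
  (forall n, op_le (T ^+ n) C) ->
  exists U, [/\ adj U * U = 1, U * adj U = 1 & U - adj U = (2 * 'i) *: T].
Proof.
move=> C0 sT TC.
have [||w [sw wE wcomm _]] := @sqrt_one_sub _ _ _ (T ^+ 2) C C0.
- by rewrite adjX sT.
- by move=> n; rewrite -exprM.
have [Y [sY TY YT]] : exists Y, [/\ adj Y = Y, T * Y = Y * T
    & Y * Y + T * T = 1].
  exists (1 - w); split; first by rewrite adjD adjN adj1 sw.
    by apply: commrB; [exact: commr1 | apply: wcomm; apply: commrX].
  by rewrite -[_ * (1 - w)]/((1 - w) ^+ 2) wE subrK.
have aU : adj (Y + 'i *: T) = Y - 'i *: T.
  by rewrite adjD adjZ sY sT conjCi scaleNr.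
have iT2 : ('i *: T) * ('i *: T) = - (T * T).
  by rewrite scale_mull scale_mulr scalerA mulCii scaleN1r.
exists (Y + 'i *: T); rewrite aU; split.
- rewrite mulrBl !mulrDr iT2 scale_mull scale_mulr TY opprD opprK addrA.
  by rewrite addrK.
- rewrite mulrBr !mulrDl iT2 scale_mull scale_mulr TY opprD opprK addrA.
  by rewrite addrK.
- by rewrite opprD opprK addrACA subrr add0r -scalerDl -[_ + _]mulr2n mulr_natl.
Qed.

Lemma op_le_unitary U : adj U * U = 1 -> op_le U 1.
Proof. by move=> UU x; rewrite (isometry_norm UU) mul1r. Qed.

(* The norm of a self-adjoint operator is its spectral radius: T is the
   imaginary part of the unitary sqrt (1 - T ^ 2) + i T. *)
Lemma op_le_power_bounded T (C : R[i]) : 0 <= C -> adj T = T ->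
  (forall n, op_le (T ^+ n) C) -> op_le T 1.
Proof.
move=> C0 sT TC; have [U [UU UU' UT]] := unitary_dilation C0 sT TC.
have -> : T = (2 * 'i)^-1 *: (U - adj U).
  by rewrite UT scalerA mulVf ?scale1r // mulf_neq0 ?pnatr_eq0 ?neq0Ci.
have i2 : `|(2 * 'i)^-1| * (1 + 1) = 1 :> R[i].
  by rewrite normfV normrM normCi mulr1 ger0_norm // mulVf // pnatr_eq0.
rewrite -[X in op_le _ X]i2; apply: op_leZ.
apply: op_leB; apply: op_le_unitary => //.
by rewrite adjK.
Qed.

(** An operator form of cos 2t = 1 - 2 (sin t)^2: if T is the imaginary part of the unitary U, then
    1 - 2 T^2 is the mean of U^2 and its adjoint. *)
Lemma op_le_one_sub_sqr T : adj T = T -> op_le T 1 ->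
  op_le (1 - 2 *: T ^+ 2) 1.
Proof.
move=> sT T1.
have [U [UU UU' UT]] := unitary_dilation ler01 sT (fun n => op_leX1 n T1).
have -> : 1 - 2 *: T ^+ 2 = 2^-1 *: (U ^+ 2 + adj U ^+ 2).
  have : (U - adj U) ^+ 2 = - (4 *: T ^+ 2).
    rewrite UT expr2 scale_mull scale_mulr scalerA -scaleNr; congr (_ *: _).
    by rewrite mulrACA mulCii mulrN1 -natrM.
  rewrite expr2 mulrBl !mulrBr UU UU' opprB addrACA -opprD => /eqP.
  rewrite subr_eq => /eqP UE.
  have -> : U ^+ 2 + adj U ^+ 2 = 2 *: (1 - 2 *: T ^+ 2).
    rewrite scalerBr scalerA -natrM [LHS]UE addrC.
    by congr (_ - _); rewrite scaler_nat mulr2n.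
  by rewrite scalerA mulVf ?scale1r ?pnatr_eq0.
apply: op_le_half; apply: op_leX1; apply: op_le_unitary => //.
by rewrite adjK.
Qed.

(* T is power bounded because T^2 is. *)
Lemma op_le_sqr T : adj T = T -> op_le (T ^+ 2) 1 -> op_le T 1.
Proof.
move=> sT T1; have [M M0 TM] := adjointable_bounded T.
apply: (@op_le_power_bounded _ (1 + M)); rewrite ?addr_ge0 // => n.
rewrite -(odd_double_half n) exprD -muln2 mulnC exprM.
rewrite -[1 + M]mulr1; apply: op_leM; rewrite ?addr_ge0 //; last exact: op_leX1.
case: (odd n) => /=; first by apply: op_leW TM; rewrite lerDr.
by apply: op_leW (@op_le1 _ _ _); rewrite lerDl.
Qed.

Lemma op_le_one_sub2 T : adj T = T -> op_le (T ^+ 2) 1 ->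
  op_le (1 - 2 *: T ^+ 2) 1.
Proof. by move=> sT T1; apply: op_le_one_sub_sqr => //; exact: op_le_sqr. Qed.

Lemma op_le_one_sub T : adj T = T -> op_le (T ^+ 2) 1 ->
  op_le (1 - T ^+ 2) 1.
Proof.
move=> sT T1.
have -> : 1 - T ^+ 2 = 2^-1 *: (1 + (1 - 2 *: T ^+ 2)).
  rewrite addrA scalerBr scalerA mulVf ?pnatr_eq0 // scale1r.
  by rewrite scale_halfD.
by apply: op_le_half; [exact: op_le1 | exact: op_le_one_sub2].
Qed.

(** The working notion of positivity: a contractive square T satisfies |1 - T| <= 1, which is not
    yet known for the form S^* S. *)
Definition is_square T : Prop := exists2 S, adj S = S & T = S ^+ 2.

Lemma is_squareZ (a : R[i]) T : 0 <= a -> is_square T -> is_square (a *: T).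
Proof.
move=> a0 [S sS ->]; exists (sqrtC a *: S).
  by rewrite adjZ sS geC0_conj // sqrtC_ge0.
by rewrite [RHS]expr2 scale_mull scale_mulr scalerA -expr2 sqrtCK.
Qed.

Lemma is_square_adj T : is_square T -> adj T = T.
Proof. by move=> [S sS ->]; rewrite adjX sS. Qed.

Lemma is_square_one_sub T (M : R[i]) : 0 < M -> is_square T -> op_le T M ->
  op_le (1 - M^-1 *: T) 1.
Proof.
move=> M0 Tsq TM.
have M'0 : 0 <= M^-1 by rewrite invr_ge0 ltW.
have [S sS SE] := is_squareZ M'0 Tsq; rewrite SE; apply: op_le_one_sub => //.
rewrite -SE [X in op_le _ X](_ : 1 = `|M^-1| * M); first exact: op_leZ.
by rewrite ger0_norm // mulVf // gt_eqF.
Qed.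

(* After scaling, S and T are contractive; then so are 1 - S, 1 - T and their
   mean Z, and S + T = 2 (1 - Z). *)
Lemma is_squareD S T : is_square S -> is_square T -> is_square (S + T).
Proof.
move=> Ssq Tsq.
have [M M0 SM] := adjointable_bounded S.
have [N N0 TN] := adjointable_bounded T.
pose K := M + N + 1.
have K0 : 0 < K by rewrite ltr_wpDl // addr_ge0.
have SK : op_le S K by apply: op_leW SM; rewrite /K -addrA lerDl addr_ge0.
have TK : op_le T K.
  by apply: op_leW TN; rewrite /K [M + N]addrC -addrA lerDl addr_ge0.
pose Z := 2^-1 *: ((1 - K^-1 *: S) + (1 - K^-1 *: T)).
have Z1 : op_le Z 1.
  by apply: op_le_half; exact: is_square_one_sub.
have ZE : S + T = (2 * K) *: (1 - Z).
  rewrite /Z addrACA -opprD -scalerDr [2^-1 *: _]scalerBr scale_halfD subKr.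
  rewrite !scalerA.
  have -> : 2 * K / 2 / K = 1 by field; rewrite gt_eqF.
  by rewrite scale1r.
have sZ : adj Z = Z.
  have ZE' : Z = 1 - (2 * K)^-1 *: (S + T).
    rewrite ZE scalerA mulVf ?scale1r ?subKr //.
    by rewrite mulf_neq0 ?pnatr_eq0 // gt_eqF.
  rewrite ZE' adjD adjN adjZ adj1 adjD !is_square_adj // geC0_conj //.
  by rewrite invr_ge0 mulr_ge0 // ltW.
have [W [sW WE _ _]] := sqrt_one_sub ler01 sZ (fun n => op_leX1 n Z1).
rewrite ZE; apply: is_squareZ; first by rewrite mulr_ge0 // ltW.
by exists (1 - W); rewrite // adjD adjN adj1 sW.
Qed.

(** T / (1 + d) is power bounded for every d > 0, since (1 + d)^n >= 1 + n d dominates 1 + C n up to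
    the factor 1 + C / d; then d tends to 0. *)
Lemma op_le_power_linear T (C : R[i]) : 0 <= C -> adj T = T ->
  (forall n, op_le (T ^+ n) (1 + C * n%:R)) -> op_le T 1.
Proof.
move=> C0 sT TC; apply: (@op_le_lim _ _ _ _ _ 1) => // m.
rewrite div1r; set d := m.+1%:R^-1.
have d0 : 0 < d by rewrite invr_gt0 ltr0Sn.
have d10 : 0 < 1 + d by rewrite addr_gt0.
have d1'0 : 0 <= (1 + d)^-1 by rewrite invr_ge0 ltW.
have -> : T = (1 + d) *: ((1 + d)^-1 *: T).
  by rewrite scalerA mulfV ?gt_eqF // scale1r.
rewrite -[X in op_le _ X]mulr1 -[X in op_le _ (X * _)]ger0_norm ?ltW //.
apply: op_leZ; apply: (@op_le_power_bounded _ (1 + C / d)).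
- by rewrite addr_ge0 // divr_ge0 // ltW.
- by rewrite adjZ sT geC0_conj.
move=> n; have -> : ((1 + d)^-1 *: T) ^+ n = (1 + d) ^- n *: T ^+ n.
  elim: n => [|n IH]; first by rewrite !expr0 invr1 scale1r.
  by rewrite !exprS IH scale_mull scale_mulr scalerA invfM.
apply: (@op_leW _ _ _ _ (`|(1 + d) ^- n| * (1 + C * n%:R))); last exact: op_leZ.
have dn0 : 0 < (1 + d) ^+ n by rewrite exprn_gt0.
rewrite ger0_norm ?invr_ge0 ?(ltW dn0) // ler_pdivrMl //.
have bern : 1 + n%:R * d <= (1 + d) ^+ n.
  elim: n {dn0} => [|n IH]; first by rewrite mul0r addr0.
  rewrite exprS; apply: le_trans (ler_wpM2l (ltW d10) IH).
  have -> : (1 + d) * (1 + n%:R * d) = 1 + n.+1%:R * d + n%:R * d ^+ 2.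
    by rewrite -natr1; ring.
  by rewrite lerDl mulr_ge0 // exprn_ge0 // ltW.
apply: le_trans (ler_wpM2r _ bern); last first.
  by rewrite addr_ge0 // divr_ge0 // ltW.
have -> : (1 + n%:R * d) * (1 + C / d) =
    (1 + C * n%:R) + (n%:R * d + C / d).
  by field; rewrite gt_eqF.
by rewrite lerDl addr_ge0 // ?divr_ge0 ?mulr_ge0 // ltW.
Qed.

End PositiveOperators.

(** * Fukamiya's theorem and positive roots *)

Section PositiveRoots.
Variables (R : realType) (A : cstarAlgType R) (X : hilbertModType A).
Local Notation L := (adjointable X).
Implicit Types S T U V W : L.

Lemma op_le_scale_inv T (M : R[i]) : 0 < M -> op_le T M -> op_le (M^-1 *: T) 1.
Proof.
move=> M0 TM.
have M1 : `|M^-1| * M = 1 by rewrite gtr0_norm ?invr_gt0 // mulVf // gt_eqF.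
by rewrite -[X in op_le _ X]M1; apply: op_leZ.
Qed.

(** Scaling S by this real [s] scales S^* S by 1 / M. *)
Lemma sqrtC_inv_sqr (M : R[i]) : 0 < M ->
  exists2 s : R[i], s^* = s & s * s = M^-1.
Proof.
move=> M0; exists (sqrtC M^-1); last by rewrite -expr2 sqrtCK.
by rewrite geC0_conj // sqrtC_ge0 invr_ge0 ltW.
Qed.

(** S S^* + S^* S = (P^2 + Q^2) / 2 with P, Q self-adjoint, so S S^* is this plus T^2, a sum of
    squares. *)
Lemma is_square_mul_adj S T : adj T = T -> adj S * S = - T ^+ 2 ->
  is_square (S * adj S).
Proof.
move=> sT ST.
pose P := S + adj S; pose Q := 'i *: (S - adj S).
have sP : adj P = P by rewrite adjD adjK addrC.
have sQ : adj Q = Q.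
  by rewrite adjZ adjD adjN adjK conjCi scaleNr -scalerN opprB.
have -> : S * adj S = 2^-1 *: (P ^+ 2 + Q ^+ 2) + T ^+ 2.
  pose H := adj S * S.
  have P2 : P ^+ 2 = S * S + S * adj S + (H + adj S * adj S).
    by rewrite expr2 mulrDl !mulrDr.
  have Q2 : Q ^+ 2 = - (S * S) + S * adj S + (H - adj S * adj S).
    rewrite expr2 scale_mull scale_mulr scalerA mulCii scaleN1r.
    by rewrite mulrBl !mulrBr !opprB addrC [S * adj S - _]addrC.
  rewrite P2 Q2.
  rewrite [X in 2^-1 *: X](AC ((2*2)*(2*2)) (((2*3)*(6*7))*((1*5)*(4*8)))) /=.
  by rewrite !subrr !addr0 scale_halfD -addrA /H ST addNr addr0.
apply: is_squareD; last by exists T.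
apply: is_squareZ; first by rewrite invr_ge0.
by apply: is_squareD; [exists P | exists Q].
Qed.

(* Let G = S S^*, contractive, with S^* S = - T^2.  Then G is a square, so
   |1 - G| <= 1.  Moreover |1 + S^* S| = |1 - T^2| <= 1 bounds
   G (1 + G)^n = S (1 + S^* S)^n S^*, so (1 + G)^n grows at most linearly and
   |1 + G| <= 1.  Now 4 G = (1 + G)^2 - (1 - G)^2. *)
Lemma op_le_mul_adj_half S T : adj T = T -> adj S * S = - T ^+ 2 ->
  op_le (S * adj S) 1 -> op_le (S * adj S) 2^-1.
Proof.
move=> sT ST; set G := S * adj S => G1.
have [Y sY GE] : is_square G := is_square_mul_adj sT ST.
have sG : adj G = G by rewrite adjM adjK.
have [M M0 SM] := adjointable_bounded S.
have [N N0 SN] := adjointable_bounded (adj S).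
pose C := N * M + 1.
have C0 : 0 <= C by rewrite addr_ge0 // mulr_ge0.
(* The powers of T^2 = - S^* S regroup around powers of [G], so they are bounded and T^2 is
   contractive. *)
have TX n : (T ^+ 2) ^+ n.+1 = (-1) ^+ n.+1 *: (adj S * G ^+ n * S).
  elim: n => [|n IH].
    by rewrite !expr1 expr0 mulr1 ST scaleN1r opprK.
  rewrite exprSr IH [_ ^+ n.+2]exprSr [G ^+ n.+1]exprSr.
  have -> : T ^+ 2 = -1 *: (adj S * S) by rewrite ST scaleN1r opprK.
  by rewrite scale_mull scale_mulr scalerA !mulrA.
have T2C n : op_le ((T ^+ 2) ^+ n) C.
  case: n => [|n].
    by apply: op_leW (@op_le1 _ _ _); rewrite lerDr mulr_ge0.
  have sgn : `|(-1) ^+ n.+1| * (N * 1 * M) = N * M :> R[i].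
    by rewrite normrX normrN1 expr1n mul1r mulr1.
  rewrite TX; apply: (@op_leW _ _ _ _ (N * M)); first by rewrite lerDl.
  rewrite -[X in op_le _ X]sgn; apply: op_leZ.
  apply: op_leM => //; first by rewrite mulr1.
  by apply: op_leM => //; exact: op_leX1.
have T21 : op_le (T ^+ 2) 1.
  by apply: (op_le_power_bounded C0 _ T2C); rewrite adjX sT.
have SS1 : op_le (1 + adj S * S) 1 by rewrite ST; exact: op_le_one_sub.
have G1m : op_le (1 - G) 1 by rewrite GE; apply: op_le_one_sub; rewrite -?GE.
(* S^* (1 + G) = (1 + S^* S) S^*, applied n times. *)
have GX n : G * (1 + G) ^+ n = S * (1 + adj S * S) ^+ n * adj S.
  elim: n => [|n IH]; first by rewrite !expr0 !mulr1.
  rewrite !exprSr mulrA IH -!mulrA; congr (_ * (_ * _)).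
  by rewrite mulrDr mulrDl mulr1 mul1r mulrA.
(* (1 + G)^(n+1) = (1 + G)^n + G (1 + G)^n, and the last term is at most N M <= C. *)
have G1p : op_le (1 + G) 1.
  apply: (op_le_power_linear C0); first by rewrite adjD adj1 sG.
  elim=> [|n IH]; first by rewrite mulr0 addr0; exact: op_le1.
  rewrite exprS mulrDl mul1r -natr1 mulrDr mulr1 addrA; apply: op_leD => //.
  rewrite GX; apply: (@op_leW _ _ _ _ (M * 1 * N)).
    by rewrite mulr1 mulrC lerDl.
  apply: op_leM => //; first by rewrite mulr1.
  by apply: op_leM => //; exact: op_leX1.
have -> : G = 4^-1 *: ((1 + G) ^+ 2 - (1 - G) ^+ 2).
  have GC : GRing.comm (1 + G) (1 - G).
    apply: commrB; first exact: commr1.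
    by apply: commr_sym; apply: commrD; first exact: commr1.
  have GB : 1 + G - (1 - G) = G + G by rewrite opprB addrC addrA subrK.
  have GD : 1 + G + (1 - G) = 1 + 1 by rewrite addrACA subrr addr0.
  have q : 4^-1 = 2^-1 * 2^-1 :> R[i] by field.
  by rewrite (subr_sqr_comm GC) GB GD mulrDr mulr1 q -scalerA !scale_halfD.
have h : `|4^-1| * (1 + 1) = 2^-1 :> R[i].
  by rewrite gtr0_norm ?invr_gt0 ?ltr0Sn //; field.
rewrite -[X in op_le _ X]h; apply: op_leZ; apply: op_leB; exact: op_leX1.
Qed.

(** Fukamiya's theorem: after rescaling, any bound on S S^* can be halved, so S S^* = 0. *)
Lemma adj_mul_eq_opp_sqr S T : adj T = T -> adj S * S = - T ^+ 2 -> S = 0.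
Proof.
move=> sT ST.
have halve (M : R[i]) :
    0 <= M -> op_le (S * adj S) M -> op_le (S * adj S) (M / 2).
  rewrite le_eqVlt => /orP[/eqP <-|M0 SM]; first by rewrite mul0r.
  have [s sR sM] := sqrtC_inv_sqr M0.
  pose S' := s *: S; pose T' := s *: T.
  have SE' : S' * adj S' = M^-1 *: (S * adj S).
    by rewrite /S' adjZ sR scale_mull scale_mulr scalerA sM.
  have S'T' : adj S' * S' = - T' ^+ 2.
    rewrite /S' adjZ sR scale_mull scale_mulr scalerA ST scalerN; congr (- _).
    by rewrite /T' [RHS]expr2 scale_mull scale_mulr scalerA.
  have S'1 : op_le (S' * adj S') 1 by rewrite SE'; exact: op_le_scale_inv.
  have sT' : adj T' = T' by rewrite adjZ sR sT.
  have := op_leZ M (op_le_mul_adj_half sT' S'T' S'1).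
  by rewrite SE' scalerA divff ?gt_eqF // scale1r gtr0_norm.
have [M M0 SM] := adjointable_bounded (S * adj S).
have SMn n : op_le (S * adj S) (M / (2 ^ n)%:R).
  elim: n => [|n IH]; first by rewrite expn0 divr1.
  rewrite expnSr natrM invfM mulrA; apply: halve => //.
  by rewrite divr_ge0.
have SS0 : S * adj S = 0.
  apply: (op_le_lim_eq0 M0) => n; apply: op_leW (SMn n).
  by rewrite ler_wpM2l // lef_pV2 ?posrE ?ltr0n ?expn_gt0 // ler_nat ltn_expl.
have S0 : adj S = 0 by apply: adj_mul_eq0; rewrite adjK.
by rewrite -(adjK S) S0; apply: adjointable_eq.
Qed.

(* Q = sqrt (P^2) is the square of some Y, and F = Q - P satisfies
   Q F = - P F, so that (S F)^* (S F) = F P F = - (Y F)^2. *)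
Lemma positive_contraction_sqrt S P : P = adj S * S -> op_le P 1 ->
  exists2 Q, P = 1 - Q & forall T, GRing.comm T (P ^+ 2) -> GRing.comm T Q.
Proof.
move=> PE P1.
have sP : adj P = P by rewrite PE adjM adjK.
pose Z := 1 - P ^+ 2.
have P21 : op_le (P ^+ 2) 1 by exact: op_leX1.
have Z1 : op_le Z 1 by exact: op_le_one_sub.
have sZ : adj Z = Z by rewrite adjD adjN adj1 adjX sP.
have [W [sW WE Wcomm W1]] := sqrt_one_sub ler01 sZ (fun n => op_leX1 n Z1).
(* 1 - W is the root of P^2 that becomes [Q]; since W is power bounded, it has a square root [Y] in
   turn. *)
have [W' [sW' W'E W'comm _]] := sqrt_one_sub ler01 sW W1.
have commW T : GRing.comm T (P ^+ 2) -> GRing.comm T W.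
  by move=> TP; apply: Wcomm; apply: commrB => //; exact: commr1.
have PW : GRing.comm P W by apply: commW; apply: commrX.
have [Y [sY Y2 PY]] : exists Y, [/\ adj Y = Y, Y ^+ 2 = 1 - W & GRing.comm P Y].
  exists (1 - W'); split => //; first by rewrite adjD adjN adj1 sW'.
  by apply: commrB; [exact: commr1 | exact: W'comm].
suff P1W : 1 - W - P = 0.
  by exists W => //; apply/esym/eqP; rewrite -subr_eq0 P1W.
have PQ : GRing.comm P (1 - W) by apply: commrB => //; exact: commr1.
have sQ : adj (1 - W) = 1 - W by rewrite adjD adjN adj1 sW.
move: WE; rewrite subKr.
move: (1 - W) Y2 PQ sQ => Q Y2 PQ sQ Q2.
have YQ : GRing.comm Y Q by rewrite -Y2; apply: commrX.
pose F := Q - P.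
have sF : adj F = F by rewrite adjD adjN sQ sP.
have YF : GRing.comm Y F by apply: commrB => //; exact: commr_sym.
have PF : GRing.comm P F by apply: commrB.
have QPF : Q * F = - (P * F).
  apply/eqP; rewrite -addr_eq0 -mulrDl mulrBr !mulrDl PQ opprD addrA.
  by rewrite addrK -[Q * Q]/(Q ^+ 2) Q2 subrr.
have SF0 : S * F = 0.
  apply: (@adj_mul_eq_opp_sqr _ (Y * F)).
    by rewrite adjM sF sY.
  rewrite adjM sF -mulrA [adj S * _]mulrA -PE mulrA -PF.
  have -> : (Y * F) ^+ 2 = Q * F * F.
    by rewrite expr2 mulrA -(mulrA Y F Y) -YF (mulrA Y Y F) -expr2 Y2.
  by rewrite QPF mulNr opprK.
have PF0 : P * F = 0 by rewrite PE -mulrA SF0 mulr0.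
apply: (selfadjoint_sqr_eq0 sF).
by rewrite expr2 mulrBl QPF PF0 oppr0 addr0.
Qed.

(** Scaling reduces to a contraction, and commuting with P^2 is invariant under scaling. *)
Lemma comm_positive_root S P V : P = adj S * S ->
  GRing.comm V (P ^+ 2) -> GRing.comm V P.
Proof.
move=> PE VP; have [M M0 PM] := adjointable_bounded P.
have K0 : 0 < M + 1 by rewrite ltr_wpDl.
have PK : op_le P (M + 1) by apply: op_leW PM; rewrite lerDl.
have [s sR sK] := sqrtC_inv_sqr K0.
pose P' := (M + 1)^-1 *: P.
have PE' : P' = adj (s *: S) * (s *: S).
  by rewrite adjZ sR scale_mull scale_mulr scalerA sK -PE.
have [Q PQ Qcomm] := positive_contraction_sqrt PE' (op_le_scale_inv K0 PK).
have VP' : GRing.comm V (P' ^+ 2).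
  rewrite /P' expr2 scale_mull scale_mulr scalerA.
  by rewrite /GRing.comm scale_mull scale_mulr -expr2 VP.
have -> : P = (M + 1) *: P' by rewrite scalerA divff ?scale1r // gt_eqF.
rewrite PQ /GRing.comm scale_mull scale_mulr; congr (_ *: _).
by apply: commrB; [exact: commr1 | exact: Qcomm].
Qed.

End PositiveRoots.

(** * Normality, polar decomposition and the unitary factor *)

Theorem corollary2p4 (R : realType) (A : cstarAlgType R)
    (X : hilbertModType A) (T V absT : adjointable X)
    (hpolar : polar_decomposition T V absT) :
  (normal T <->
     exists U : adjointable X, unitary U /\ T =1 U \o adj T) /\
  (forall U : adjointable X, unitary U -> T =1 U \o adj T ->
     U \o T =1 T \o U /\ U \o adj T =1 adj T \o U).
Proof.
(* Pointwise identities are turned into equations in the ring L(X). *)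
have eqM (S S' W W' : adjointable X) : S * S' = W * W' <-> S \o S' =1 W \o W'.
  split=> [SW x|SW]; first exact: (congr1 (fun Z => aop Z x) SW).
  by apply: adjointable_eq => x; exact: SW.
have eqM1 (S S' : adjointable X) : S * S' = 1 <-> S \o S' =1 id.
  split=> [SS x|SS]; first exact: (congr1 (fun Z => aop Z x) SS).
  by apply: adjointable_eq => x; exact: SS.
have eqMr (S W W' : adjointable X) : S = W * W' <-> S =1 W \o W'.
  split=> [SW x|SW]; first exact: (congr1 (fun Z => aop Z x) SW).
  by apply: adjointable_eq => x; exact: SW.
have adjTU U : T = U * adj T -> adj T = T * adj U.
  by move=> TU; rewrite [in LHS]TU adjM adjK.
have TaU U : adj U * U = 1 -> T = U * adj T -> T = adj T * U.
  by move=> UU TU; rewrite (adjTU _ TU) -mulrA UU mulr1.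
split; last first.
  move=> U [/eqM1 UU _] /eqMr TU; have TU' := TaU U UU TU.
  split; apply/eqM; last by rewrite -TU -TU'.
  by rewrite [in LHS]TU' mulrA -TU.
split=> [/eqM nT|[U [[/eqM1 UU _] /eqMr TU]]]; last first.
  apply/eqM.
  have -> : adj T * T = T * adj U * (U * adj T) by rewrite -TU -(adjTU _ TU).
  by rewrite -mulrA (mulrA (adj U)) UU mul1r.
case: hpolar => [] [[S /eqMr PE] /eqM PP] [pV /eqMr TVP] [kerV kerV'] _ _.
have VVV : V * adj V * V = V by apply: adjointable_eq => x; exact: pV.
move: PE PP TVP; set P := absT => PE PP TVP.
have sP : adj P = P by rewrite PE adjM adjK.
(* By normality <T^* x, T^* x> = <x, T T^* x> = <x, T^* T x> = 0. *)
have kerT x : T x = 0 -> adj T x = 0.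
  move=> Tx; apply: (@inner_eq0 _ _ X).
  by rewrite aopP adjK -aop_mulE -nT aop_mulE Tx aop0 inner0r.
have kerT' x : adj T x = 0 -> T x = 0.
  move=> Tx; apply: (@inner_eq0 _ _ X).
  by rewrite aopP -aop_mulE nT aop_mulE Tx aop0 inner0r.
pose E := adj V * V; pose E' := V * adj V.
have VE : V * E = V by rewrite mulrA.
have VE' : adj V * E' = adj V by rewrite -[in RHS]VVV !adjM adjK.
have sE : adj E = E by rewrite adjM adjK.
have sE' : adj E' = E' by rewrite adjM adjK.
have kerVV x : V x = 0 <-> adj V x = 0.
  have kV y : V y = 0 <-> T y = 0 by rewrite -[V y = 0]/(Ker V y) kerV.
  have kV' y : adj V y = 0 <-> adj T y = 0.
    by rewrite -[adj V y = 0]/(Ker (adj V) y) kerV'.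
  by rewrite kV kV'; split; [exact: kerT | exact: kerT'].
(* 1 - E maps into Ker V, which is also the kernel of V^*. *)
have VsubE : adj V * (1 - E) = 0.
  apply: adjointable_eq => x; rewrite aop_mulE; apply/kerVV.
  by rewrite -aop_mulE mulrBr mulr1 VE subrr.
have VsubE' : V * (1 - E') = 0.
  apply: adjointable_eq => x; rewrite aop_mulE; apply/kerVV.
  by rewrite -aop_mulE mulrBr mulr1 VE' subrr.
(* E' = E' E and E = E E'; the adjoint of the first is E' = E E'. *)
have EE' : E = E'.
  have : E' * (1 - E) = 0 by rewrite -mulrA VsubE mulr0.
  rewrite mulrBr mulr1 => /subr0_eq E'E.
  have : E * (1 - E') = 0 by rewrite -mulrA VsubE' mulr0.
  rewrite mulrBr mulr1 => /subr0_eq EE2.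
  by rewrite [LHS]EE2 -[in RHS]sE' [in RHS]E'E adjM sE sE'.
have EV : E * V = V by rewrite EE'.
have E2 : E * E = E by rewrite -[LHS]/(adj V * V * E) -mulrA VE.
have EE1 : (1 - E) * (1 - E) = 1 - E.
  by rewrite mulrBr mulr1 mulrBl mul1r E2 subrr subr0.
(* With D = (1 - E) P, D^* D = P^2 - P V^* V P = P^2 - T^* T = 0. *)
have EP : E * P = P.
  have P1E : (1 - E) * P = 0.
    apply: adj_mul_eq0.
    rewrite adjM sP adjD adjN adj1 sE -mulrA (mulrA (1 - E)) EE1.
    rewrite mulrBl mul1r mulrBr PP TVP adjM sP /E !mulrA subrr //.
  by apply/esym/eqP; rewrite -subr_eq0 -{1}[P]mul1r -mulrBl P1E.
have PE' : P * E = P by rewrite -{2}sP -{2}EP adjM sE sP.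
(* P^2 = T^* T = T T^* = V P^2 V^*; after multiplication by V on the right, P^2 absorbs V^* V =
   E. *)
have VPP : V * P ^+ 2 = P ^+ 2 * V.
  have P2 : P ^+ 2 = V * P ^+ 2 * adj V.
    by rewrite expr2 {1}PP nT TVP adjM sP !mulrA.
  have P2E : P ^+ 2 * E = P ^+ 2 by rewrite expr2 -(mulrA P) PE'.
  by rewrite [in RHS]P2 -(mulrA _ (adj V)) -/E -(mulrA V) P2E.
have VP : V * P = P * V by exact: comm_positive_root PE VPP.
(* V^2 on the range of E, where V is unitary, and the identity on the complement. *)
pose U : adjointable X := V ^+ 2 + (1 - E).
exists U; split; last first.
  (* U T^* = V^2 P V^* = V P V V^* = V P E = T, the other term vanishing because (1 - E) P = 0. *)
  apply/eqMr; rewrite /U mulrDl [X in _ + (_ * adj X)]TVP adjM sP.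
  rewrite (mulrA (1 - E)).
  rewrite mulrBl mul1r EP subrr mul0r addr0 [in RHS]TVP adjM sP.
  by rewrite expr2 -mulrA [V * (P * _)]mulrA VP -(mulrA P) -/E' -EE' PE' -TVP.
have sU : adj U = adj V ^+ 2 + (1 - E).
  by rewrite adjD adjX adjD adjN adj1 sE.
have E1V : (1 - E) * V = 0 by rewrite mulrBl mul1r EV subrr.
have V1E : V * (1 - E) = 0 by rewrite mulrBr mulr1 VE subrr.
have E1V' : (1 - E) * adj V = 0.
  by rewrite -[LHS]adjK adjM adjK adjD adjN adj1 sE V1E; apply: adjointable_eq.
have VV2 : adj V ^+ 2 * V ^+ 2 = E.
  by rewrite !expr2 -mulrA (mulrA (adj V) V V) -/E EV.
have VV2' : V ^+ 2 * adj V ^+ 2 = E.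
  by rewrite !expr2 -mulrA (mulrA V (adj V)) -/E' -EE' mulrA VE EE'.
split; apply/eqM1; rewrite sU /U.
  rewrite mulrDl (mulrDr (adj V ^+ 2)) (mulrDr (1 - E)) VV2 EE1.
  rewrite !expr2 -(mulrA (adj V)) VsubE mulr0 addr0 (mulrA (1 - E)) E1V mul0r.
  by rewrite add0r addrC subrK.
rewrite mulrDl (mulrDr (V ^+ 2)) (mulrDr (1 - E)) VV2' EE1.
rewrite !expr2 -(mulrA V) V1E mulr0 addr0 (mulrA (1 - E)) E1V' mul0r.
by rewrite add0r addrC subrK.
Qed.
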